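(* Let $r\ge3$ be an odd integer and $a\ge r+1$ an even integer. The subtraction game $\mathcal{S}(1,a,2a+r)$ is periodic with period $3a+r$ and nim-sequence $\big((01)^{a/2}\,2\big)^2(01)^{a/2}(23)^{(r-3)/2}\,2$. Moreover, the subtraction set has expansion $\{1,a,a+2,2a+r-2,2a+r,3a+r-1\}^{*(3a+r)}$.
   Context: For a finite set $S$ of positive integers, the subtraction game $\mathcal{S}(S)$ is played on a single pile: two players alternately remove $s\in S$ coins (at most the pile size); the last mover wins. The nim-value is $\mathcal{G}(n)=\operatorname{mex}\{\mathcal{G}(n-s): s\in S, s\le n\}$. Words of single digits are written by juxtaposition, and $x^m$ denotes $m$-fold repetition of the block $x$ ($x^0$ empty). ''The game is periodic with period $p$ and nim-sequence $W$'' ($W$ a word of length $p$) means $\mathcal{G}(n+p)=\mathcal{G}(n)$ for all $n\ge0$, $p$ is the least such, and $\mathcal{G}(n)$ is the $((n\bmod p)+1)$-st letter of $W$ for all $n\ge0$. The expansion of $S$ is $S^{ex}=\{s\ge1:\mathcal{G}(n+s)\ne\mathcal{G}(n)\ \forall n\ge0\}$; ''has expansion $T$'' means $S^{ex}=T$. For a set $X$ and $p\ge1$, $X^{*p}=\{x+mp:x\in X,m\ge0\}$.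
   Formalization: That 3a+r is the least period is claimed only for r≥5: for r=3 the nim-sequence is ((01)^{a/2}2)^3, so a+1 is already a period and leastness fails; the period, nim-sequence and expansion are still asserted for r=3. *)

(* Defs.v *)
From mathcomp Require Import all_boot.
From mathcomp Require Import classical_sets.

Set Implicit Arguments.
Unset Strict Implicit.
Unset Printing Implicit Defensive.

Fact mex_exists (s : seq nat) : exists k, k \notin s.
Proof.
exists (\max_(x <- s) x).+1; apply/negP => h.
by have := @leq_bigmax_seq _ s predT id _ h isT; rewrite ltnn.
Qed.

Definition mex (s : seq nat) : nat := ex_minn (mex_exists s).

(* The recursion is on the fuel [k]; any [k > n] gives the nim-value of a pile
   of [n] coins, see [nim_valueE]. *)
Fixpoint nim_rec (S : seq nat) (k n : nat) : nat :=
  if k is k'.+1 then mex [seq nim_rec S k' (n - s) | s <- S & 0 < s <= n]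
  else 0.

(* The set of allowed moves is the set of positive entries of [S]. *)
Definition nim_value (S : seq nat) (n : nat) : nat := nim_rec S n.+1 n.

Lemma nim_rec_fuel (S : seq nat) (k n : nat) :
  n < k -> nim_rec S k n = nim_value S n.
Proof.
have fuel : forall k1 k2 m, m < k1 -> m < k2 -> nim_rec S k1 m = nim_rec S k2 m.
  elim=> [|k1 IH] [|k2] m //= m1 m2; congr mex; apply/eq_in_map => s.
  rewrite mem_filter => /andP[/andP[s0 sm] _].
  have lt_m : m - s < m by rewrite ltn_subrL s0 (leq_trans s0 sm).
  by apply: IH; apply: leq_trans lt_m _.
by move=> nk; apply: fuel.
Qed.

Lemma nim_valueE (S : seq nat) (n : nat) :
  nim_value S n = mex [seq nim_value S (n - s) | s <- S & 0 < s <= n].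
Proof.
rewrite {1}/nim_value /=; congr mex; apply/eq_in_map => s.
rewrite mem_filter => /andP[/andP[s0 sn] _]; apply: nim_rec_fuel.
by rewrite ltn_subrL s0 (leq_trans s0 sn).
Qed.

Definition word_pow (w : seq nat) (m : nat) : seq nat := flatten (nseq m w).

Definition is_period (S : seq nat) (p : nat) : Prop :=
  0 < p /\ forall n, nim_value S (n + p) = nim_value S n.

Definition repeats_word (S : seq nat) (p : nat) (W : seq nat) : Prop :=
  [/\ size W = p, is_period S p & forall n, nim_value S n = nth 0 W (n %% p)].

Definition periodic_with_nim_sequence (S : seq nat) (p : nat) (W : seq nat) :
    Prop :=
  repeats_word S p W /\ forall q, is_period S q -> p <= q.

Definition expansion (S : seq nat) : set nat :=
  [set s | 0 < s /\ forall n, nim_value S (n + s) <> nim_value S n]%classic.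

Definition periodic_extension (X : set nat) (p : nat) : set nat :=
  [set y | exists x m, X x /\ y = x + m * p]%classic.

(* Main.v *)
Require Import Defs.
From mathcomp Require Import all_boot.
From mathcomp Require Import classical_sets.
From mathcomp Require Import zify.

(** Modulo the period [p = 3a + r] the moves are [1], [a] and [-a]. That the
    word takes distinct values at distance [1], [a] and [a + 2] (cyclically)
    shows both that moves change the value and that the six listed residues,
    which are [±1], [±a], [±(a + 2)], lie in the expansion. Conversely, every
    other residue is, up to sign, a difference of two positions of the letter
    [0]. For [r > 3], the letter [3] first occurs at position [3a + 3], so no
    period is [<= 3a + 3], while the letters from there up to position [p - 1]
    differ from the initial letter [0]. *)

Lemma mexP (s : seq nat) (k : nat) :
  k \notin s -> (forall j, j < k -> j \in s) -> mex s = k.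
Proof.
rewrite /mex => ks js; case: ex_minnP => m ms min_m.
apply/eqP; rewrite eqn_leq min_m //= leqNgt.
by apply/negP => /js; rewrite (negPf ms).
Qed.

Lemma size_word_pow (w : seq nat) (m : nat) :
  size (word_pow w m) = m * size w.
Proof. by elim: m => //= m IH; rewrite size_cat IH mulSn. Qed.

Lemma nth_word_pow2 (u v m i : nat) : i < m.*2 ->
  nth 0 (word_pow [:: u; v] m) i = if odd i then v else u.
Proof.
elim: m i => [|m IH] // [|[|i]] //=; rewrite doubleS !ltnS => lt_i.
by rewrite IH // negbK.
Qed.

(* The letter at position [x < 3a + r] of the nim-sequence. *)
Definition letter (a x : nat) : nat :=
  if x < a then odd x : nat else
  if x == a then 2 else
  if x <= 2 * a then ~~ odd x : nat else
  if x == 2 * a + 1 then 2 else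
  if x < 3 * a + 2 then odd x : nat else 2 + odd x.

Definition nim_word (a r : nat) : seq nat :=
  word_pow (word_pow [:: 0; 1] (a %/ 2) ++ [:: 2]) 2
    ++ word_pow [:: 0; 1] (a %/ 2) ++ word_pow [:: 2; 3] ((r - 3) %/ 2)
    ++ [:: 2].

Ltac if_lia := repeat first [lia | case: ifPn => ?].

Ltac letter_lia := rewrite /letter; if_lia.

Section Game.

Variables a r : nat.
Hypotheses (r_ge3 : 3 <= r) (r_odd : odd r) (a_ge : r + 1 <= a).
Hypothesis a_even : ~~ odd a.

Let p := 3 * a + r.
Let S := [:: 1; a; 2 * a + r].
Let value n := letter a (n %% p).

Let p_gt0 : 0 < p. Proof. by rewrite /p; lia. Qed.

Lemma size_nim_word : size (nim_word a r) = p.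
Proof. by rewrite !(size_cat, size_word_pow) /= /p; lia. Qed.

Lemma nth_nim_word x : x < p -> nth 0 (nim_word a r) x = letter a x.
Proof.
(* The outer square is expanded into two copies; the inner powers are folded back for
   [nth_word_pow2]. *)
rewrite /p /nim_word /word_pow /= cats0 -!/(word_pow _ _) => lt_x.
rewrite !(nth_cat, size_cat, size_word_pow) /= /letter.
have -> : a %/ 2 * 2 = a by lia.
have -> : (r - 3) %/ 2 * 2 = r - 3 by lia.
have nth_singleton k : k = 0 -> nth 0 [:: 2] k = 2 by move->.
if_lia.
all: rewrite ?(nth_singleton, nth_word_pow2); if_lia.
Qed.

(** Splitting on whether the shift wraps past the period leaves [lia] linear goals about one
    residue. *)
Lemma value_add n t : t <= p -> value (n + t) =
  let x := n %% p in
  if x + t < p then letter a (x + t) else letter a (x + t - p).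
Proof.
move=> le_t; rewrite /value -modnDml /=; have := ltn_pmod n p_gt0.
move: (n %% p) => x lt_x; case: ltnP => h; first by rewrite modn_small.
by rewrite -{1}(subnK h) modnDr modn_small //; lia.
Qed.

Lemma value_addp n : value (n + p) = value n.
Proof. by rewrite /value modnDr. Qed.

Lemma value_shift n t : t \in [:: 1; a; a + 2] -> value (n + t) <> value n.
Proof.
move=> t_in; rewrite value_add; last by move: t_in; rewrite !inE /p; lia.
rewrite /value /=; have := ltn_pmod n p_gt0; move: (n %% p) => x.
move: t_in; rewrite !inE /p; letter_lia.
Qed.

(** The bound [s <= x] keeps the move inside one period, so an option found for a residue serves
    every pile with that residue. *)
Lemma letter_option x j : x < p -> j < letter a x ->
  exists s, [/\ s \in S, s <= x & letter a (x - s) = j].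
Proof.
move=> lt_x lt_j.
suff [s s_in /andP[le_s /eqP eq_j]] :
    exists2 s, s \in S & (s <= x) && (letter a (x - s) == j) by exists s.
have in1 : 1 \in S by rewrite inE.
have ina : a \in S by rewrite !inE eqxx orbT.
have inar : 2 * a + r \in S by rewrite !inE eqxx !orbT.
move: lt_j lt_x; rewrite /p {1}/letter.
have [lt_xa|le_ax] := ltnP x a; first by [exists 1 => //; letter_lia].
have [eq_xa|neq_xa] := x =P a.
  by have [?|?] := posnP j; [exists a => // | exists 1 => //]; letter_lia.
have [le_x2a|gt_x2a] := leqP x (2 * a); first by [exists 1 => //; letter_lia].
have [eq_x|neq_x] := x =P 2 * a + 1.
  by have [?|?] := posnP j; [exists a => // | exists 1 => //]; letter_lia.
have [lt_x3a|ge_x3a] := ltnP x (3 * a + 2).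
  by [exists 1 => //; letter_lia].
(* From the tail of 2s and 3s, [2 * a + r] leads to the first alternating block and [a] to the
   third; parity decides which reaches 0 and which reaches 1. *)
have [odd_x|even_x] := boolP (odd x) => lt_j lt_x.
  have [?|?] := posnP j; first by [exists (2 * a + r) => //; letter_lia].
  by have [?|?] := leqP j 1; [exists a => // | exists 1 => //]; letter_lia.
have [?|?] := posnP j; first by [exists a => //; letter_lia].
by exists (2 * a + r) => //; letter_lia.
Qed.

Lemma value_move n s : s \in S -> s <= n -> value (n - s) <> value n.
Proof.
move=> s_in le_sn; rewrite -{2}(subnK le_sn); move: (n - s) => m.
have [s_small|] := boolP (s \in [:: 1; a; a + 2]).
  by apply/nesym/value_shift.
rewrite !inE => s_neq; have -> : s = 2 * a + r.
  by move: s_in s_neq; rewrite !inE; lia.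
rewrite -(value_addp m).
have -> : m + p = m + (2 * a + r) + a by rewrite /p; lia.
by apply: value_shift; rewrite !inE eqxx orbT.
Qed.

(** [value] solves the recursion of [nim_value]: [value_move] keeps the value itself off the
    options, and [letter_option] puts every smaller one among them. *)
Lemma nim_value_value n : nim_value S n = value n.
Proof.
have [k] := ubnP n; elim: k n => // k IH n lt_n.
have IHs s : 0 < s <= n -> nim_value S (n - s) = value (n - s).
  by move=> ?; apply: IH; lia.
rewrite nim_valueE; apply: mexP => [|j lt_j].
  apply/mapP => -[s]; rewrite mem_filter => /andP[sn s_in].
  by rewrite IHs // => /esym; apply: value_move => //; lia.
have [s [s_in le_s <-]] := letter_option _ _ (ltn_pmod n p_gt0) lt_j.
have le_n := leq_mod n p.
apply/mapP; exists s.
  rewrite mem_filter s_in (leq_trans le_s le_n) !andbT.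
  by move: s_in; rewrite !inE; lia.
rewrite IHs; last by move: s_in; rewrite !inE; lia.
(* As [s <= n %% p], subtracting [s] keeps the quotient by [p]. *)
rewrite /value {2}(divn_eq n p) -addnBA // modnMDl.
by rewrite (modn_small (leq_ltn_trans (leq_subr _ _) (ltn_pmod n p_gt0))).
Qed.

Lemma nim_repeats_word : repeats_word S p (nim_word a r).
Proof.
split; first exact: size_nim_word.
  by split=> // n; rewrite !nim_value_value value_addp.
by move=> n; rewrite nim_value_value nth_nim_word ?ltn_pmod.
Qed.

Lemma nim_period_ge q : 3 < r -> is_period S q -> p <= q.
Proof.
move=> r_gt3 [q_gt0 per_q]; rewrite leqNgt; apply/negP => lt_q.
have {}per_q n : value (n + q) = value n by rewrite -!nim_value_value.
have [le_q|gt_q] := leqP q (3 * a + 3).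
  have := per_q (3 * a + 3 - q); rewrite subnK // /value.
  by rewrite !modn_small; [letter_lia | rewrite /p; lia..].
have := per_q 0; rewrite add0n /value mod0n modn_small //.
by move: lt_q; rewrite /p; letter_lia.
Qed.

Let residues := [:: 1; a; a + 2; 2 * a + r - 2; 2 * a + r; 3 * a + r - 1].

Lemma value_shift_residue n t : t \in residues -> value (n + t) <> value n.
Proof.
move=> t_in; have [t_small|] := boolP (t \in [:: 1; a; a + 2]).
  exact: value_shift.
move=> t_large; have pt_small : p - t \in [:: 1; a; a + 2].
  by move: t_in t_large; rewrite !inE /p; lia.
have le_t : t <= p by move: t_in; rewrite !inE /p; lia.
(* The shift by [p - t] from [n + t] ends at [n + p], which has the value of [n]. *)
rewrite -(value_addp n) -(subnKC le_t) addnA.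
exact/nesym/value_shift.
Qed.

Lemma value_repeat t : t < p -> t \notin residues ->
  exists x, value (x + t) = value x.
Proof.
move=> lt_t t_notin.
suff [x [y [lt_x lt_y eq_xy x0 y0]]] : exists x y, [/\ x < p, y < p,
    x + t = y \/ x + t = y + p, letter a x = 0 & letter a y = 0].
  exists x; case: eq_xy => ->; rewrite ?value_addp /value.
    by rewrite !modn_small // x0 y0.
  by rewrite !modn_small // x0 y0.
(* The 2 at position [a] displaces the second alternating block by one, so its zeros are at odd
   positions; the 2 at [2 * a + 1] restores parity for the third. *)
have zero1 x : x < a -> ~~ odd x -> letter a x = 0 by letter_lia.
have zero2 x : a < x <= 2 * a -> odd x -> letter a x = 0 by letter_lia.
have zero3 x : 2 * a + 1 < x < 3 * a + 2 -> ~~ odd x -> letter a x = 0.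
  by letter_lia.
have {t_notin} : [/\ t <> 1, t <> a /\ t <> a + 2,
    p - t <> a /\ p - t <> a + 2 & p - t <> 1].
  by move: t_notin; rewrite !inE /p; split; lia.
have def_p : p = 3 * a + r by [].
move=> [t_1 [t_a t_a2] [pt_a pt_a2] pt_1].
(* Since [p] is odd, wrapping flips parity. Even [t] joins zeros of block 1 to block 1 or 3, or with
   a wrap block 2 to block 1. Odd [t] joins block 1 to block 2, or with a wrap block 1 or 3 to block
   1. *)
have [t_even|t_odd] := boolP (~~ odd t).
- clear t_1 pt_a pt_a2.
  have [?|?] := leqP (t + 2) a.
    by exists 0, t; split; [lia..|apply: zero1; lia|apply: zero1; lia].
  have [?|?] := leqP (3 * a + 1) t.
    exists (a + 1), (a + 1 + t - p).
    by split; [lia..|apply: zero2; lia|apply: zero1; lia].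
  have [?|?] := leqP t (2 * a + 2).
    exists (2 * a + 2 - t), (2 * a + 2).
    by split; [lia..|apply: zero1; lia|apply: zero3; lia].
  by exists 0, t; split; [lia..|apply: zero1; lia|apply: zero3; lia].
- clear t_a t_a2 pt_1.
  have [?|?] := leqP t (a + 1).
    exists (a + 1 - t), (a + 1).
    by split; [lia..|apply: zero1; lia|apply: zero2; lia].
  have [?|?] := leqP (t + 1) (2 * a).
    by exists 0, t; split; [lia..|apply: zero1; lia|apply: zero2; lia].
  have [?|?] := leqP (p + 2) (t + a).
    by exists (p - t), 0; split; [lia..|apply: zero1; lia|apply: zero1; lia].
  exists (2 * a + 2), (2 * a + 2 + t - p).
  by split; [lia..|apply: zero3; lia|apply: zero1; lia].
Qed.

Lemma value_addMp n m : value (n + m * p) = value n.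
Proof. by rewrite /value addnC modnMDl. Qed.

Lemma nim_expansionP s :
  expansion S s <-> periodic_extension [set` residues]%classic p s.
Proof.
split=> [[s_gt0 neq_s]|[t [m [t_in ->]]]].
  exists (s %% p), (s %/ p); split; last by rewrite addnC -divn_eq.
  (* A repetition at the distance [s %% p] is also one at the distance [s]; this covers multiples of
     [p], whose residue 0 is not listed. *)
  apply/negPn/negP => /(value_repeat _ (ltn_pmod s p_gt0)) [x eq_x].
  apply: (neq_s x); rewrite !nim_value_value -eq_x {1}(divn_eq s p).
  by rewrite addnCA addnC value_addMp.
split=> [|n]; first by move: t_in; rewrite /= !inE; lia.
rewrite !nim_value_value addnA value_addMp.
exact: value_shift_residue.
Qed.

End Game.

(* For r = 3 the word below is the cube of (01)^(a/2) 2, so that the least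
   period is a + 1 and not 3a + r; minimality therefore needs 3 < r. *)
Theorem theorem3p11 (a r : nat) (r_ge3 : 3 <= r) (r_odd : odd r)
    (a_ge : r + 1 <= a) (a_even : ~~ odd a) :
  let S := [:: 1; a; 2 * a + r] in
  let p := 3 * a + r in
  let W := word_pow (word_pow [:: 0; 1] (a %/ 2) ++ [:: 2]) 2
             ++ word_pow [:: 0; 1] (a %/ 2)
             ++ word_pow [:: 2; 3] ((r - 3) %/ 2)
             ++ [:: 2] in
  [/\ repeats_word S p W,
      3 < r -> periodic_with_nim_sequence S p W
    & expansion S =
      periodic_extension
        [set 1; a; a + 2; 2 * a + r - 2; 2 * a + r; 3 * a + r - 1]%classic p].
Proof.
move=> S p W; have rep : repeats_word S p W by apply: nim_repeats_word.
split=> // [r_gt3|].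
  by split=> // q; apply: nim_period_ge.
apply/seteqP; split=> s.
  move=> /(nim_expansionP _ _ r_ge3 r_odd a_ge a_even) [t [m [t_in ->]]].
  exists t, m; split=> //.
  move: t_in; rewrite /= !inE.
  by do 5 (case/orP=> [/eqP ->|]; first by do ?[by right | left]);
    move/eqP=> ->; right.
move=> [t [m [t_in ->]]]; apply/(nim_expansionP _ _ r_ge3 r_odd a_ge a_even).
exists t, m; split=> //; rewrite /= !inE.
by move: t_in => [[[[[]|]|]|]|] ->; rewrite eqxx ?orbT.
Qed.
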